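(* Let $p>0$, $q>0$ and $m\in\mathbb{N}$. Let $\mathbf{b}=(b_k)_{k\in\mathbb{N}}\subset\mathbb{C}$ be a sequence such that $$\lim_{n\to\infty}\frac{1}{n^p}\sum_{k=1}^n b_k=b\in\mathbb{C},$$ and suppose that there is a finite constant $B$ with $$\frac{1}{n^p}\sum_{k=1}^n|b_k|\leq B\qquad\text{for all } n\in\mathbb{N}.$$ Let $(a_{k_1,\ldots,k_m})_{k_1,\ldots,k_m\in\mathbb{N}}\subset\mathbb{C}$ be a multi-indices sequence such that $$\lim_{n\to\infty}\frac{1}{n^{q}}\sum_{1\leq k_1,\ldots,k_m\leq n}a_{k_1,\ldots,k_m}=a\in\mathbb{C}.$$ Then $$\lim_{n\to\infty}\frac{1}{n^{p+q}}\sum_{k=1}^n b_k\sum_{1\leq k_1,\ldots,k_m\leq k}a_{k_1,\ldots,k_m}=\frac{abp}{p+q}.$$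
   Context: $\mathbb{N}=\{1,2,3,\dots\}$. The notation $\sum_{1\leq k_1,\ldots,k_m\leq n}$ means the sum over all $m$-tuples $(k_1,\dots,k_m)$ of natural numbers with $1\le k_i\le n$ for each $i=1,\dots,m$. *)

(* Defs.v *)
From HB Require Import structures.
From mathcomp Require Export all_boot all_order all_algebra.
From mathcomp Require Export all_classical all_reals all_analysis.
From mathcomp Require Export complex.
Export Order.TTheory GRing.Theory Num.Theory numFieldNormedType.Exports.

Set Implicit Arguments.
Unset Strict Implicit.
Unset Printing Implicit Defensive.

Local Open Scope ring_scope.
Local Open Scope complex_scope.

(* Sequences indexed by {1, 2, 3, ...} are represented by functions on nat (or
   on tuples of nat) that are only ever evaluated at indices >= 1. *)

(* The sum of a_{k_1,...,k_m} over 1 <= k_1, ..., k_m <= n. The elements of 'I_n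
   are 0, ..., n-1, whence the shift by one. *)
Definition box_sum (R : realType) (m : nat) (a : m.-tuple nat -> R[i])
    (n : nat) : R[i] :=
  \sum_(k : m.-tuple 'I_n) a [tuple (tnth k j).+1 | j < m].

(* n ^ r, for a real exponent r, as a complex number. *)
Definition npow (R : realType) (n : nat) (r : R) : R[i] := (n%:R `^ r)%:C.

(* Main.v *)
Require Import Defs.
From mathcomp Require Import ring.

(** The proof rests on a single principle, a form of Toeplitz's theorem on
    weighted means ([weighted_mean_cvg]): if [1 / s n -> 0], the weights satisfy
    [\sum_(k < n) |w k| <= C |s n|], their normalized sums
    [(s n)^-1 \sum_(k < n) w k] tend to [rho], and [e k -> l], then the
    normalized sums of [w k * e k] tend to [rho * l].

    Write [A k] for the box sum of [a] and [alpha k = A k / k^q], so that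
    [alpha -> a].  Then [b_k * A k = (b_k * k^q) * alpha k] and the principle,
    with [s n = n^(p + q)], weights [b_k * k^q] and [C = B], gives the limit
    [rho * a] as soon as the normalized sums of [b_k * k^q] tend to some [rho].

    To find [rho = b p / (p + q)] ([powR_weighted_sum_cvg]), let
    [beta k = (b_1 + ... + b_k) / k^p], so that [beta -> b].  Summation by parts
    turns [\sum_(k <= n) b_k k^q] into
      [n^(p + q) beta n - \sum_(k < n) k^p ((k + 1)^q - k^q) * beta k].
    The principle applies again, with weights [k^p ((k + 1)^q - k^q)], and
    yields [b - (q / (p + q)) b = b p / (p + q)], provided that the normalized
    sums of these weights tend to [q / (p + q)] ([nat_powR_mean_cvg]).

    This last fact is a third instance: as [n^(p + q)] is the telescoping sum of
    [(k + 1)^(p + q) - k^(p + q)], it suffices that the ratio of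
    [k^p ((k + 1)^q - k^q)] to [(k + 1)^(p + q) - k^(p + q)] tends to
    [q / (p + q)].  With [h = 1 / k] this ratio is
    [((1 + h)^q - 1) / ((1 + h)^(p + q) - 1)], a quotient of two difference
    quotients at [1] of power functions. *)

Local Open Scope classical_set_scope.
Local Open Scope ring_scope.
Local Open Scope complex_scope.

(** * Weighted means *)

(** The terms with [k < N] contribute a fixed quantity divided by [s n], and the
    later ones at most the bound on the weights times the supremum of [`|e k|]
    for [k >= N].  The order of a numeric field such as the complex numbers is
    partial, but all that is compared here is nonnegative: [C * `|s n|] is so
    because it bounds a sum of norms. *)
Lemma weighted_sum_cvg0 {K : numFieldType} {s w e : nat -> K} {C : K} :
  (fun n => (s n)^-1) @ \oo --> (0 : K^o) ->
  (forall n, \sum_(0 <= k < n) `|w k| <= C * `|s n|) ->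
  e @ \oo --> (0 : K^o) ->
  (fun n => (s n)^-1 * \sum_(0 <= k < n) w k * e k) @ \oo --> (0 : K^o).
Proof.
move=> s0 wC e0.
have normC_real n : 0 <= C * `|s n|.
  by apply: le_trans (wC n); apply: sumr_ge0 => k _.
(* A positive bound that also covers the indices at which [s] vanishes. *)
have [D D0 wD] : exists2 D : K, 0 < D &
    forall n, `|(s n)^-1| * \sum_(0 <= k < n) `|w k| <= D.
  exists (`|C| + 1) => [|n]; first by rewrite ltr_wpDl.
  have [->|sn0] := eqVneq (s n) 0; first by rewrite invr0 normr0 mul0r addr_ge0.
  rewrite normfV mulrC ler_pdivrMr ?normr_gt0//.
  apply: (le_trans (wC n)).
  rewrite -(ger0_norm (normC_real n)) normrM normr_id ler_wpM2r// lerDl.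
  exact: ler01.
apply/cvgr0Pnorm_lt => eps; rewrite -[eps]/(eps : K) => eps0.
have eps2D : 0 < eps / 2 / D by rewrite !divr_gt0.
have /cvgr0Pnorm_lt/(_ _ eps2D)[N _ eN] := e0.
pose T : K := \sum_(0 <= k < N) `|w k * e k|.
have T1 : 0 < T + 1 by rewrite ltr_wpDl ?ltr01// sumr_ge0.
have eps2T : 0 < eps / 2 / (T + 1) by rewrite !divr_gt0.
have /cvgr0Pnorm_lt/(_ _ eps2T) sT := s0.
near=> n.
have Nn : (N <= n)%N by near: n; exact: nbhs_infty_ge.
rewrite normrM [eps]splitr (big_cat_nat (leq0n N) Nn)/=.
apply: (le_lt_trans (ler_wpM2l (normr_ge0 _) (ler_normD _ _))).
rewrite mulrDr ltr_leD//.
  apply: (@le_lt_trans _ _ (`|(s n)^-1| * T)).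
    by rewrite ler_wpM2l//; exact: ler_norm_sum.
  apply: (@le_lt_trans _ _ (`|(s n)^-1| * (T + 1))).
    by rewrite ler_wpM2l// lerDl ler01.
  rewrite -ltr_pdivlMr//.
  by near: n.
apply: (@le_trans _ _ (`|(s n)^-1| *
    ((\sum_(0 <= k < n) `|w k|) * (eps / 2 / D)))).
  rewrite ler_wpM2l//; apply: (le_trans (ler_norm_sum _ _ _)).
  rewrite [in leRHS](big_cat_nat (leq0n N) Nn)/= mulrDl ler_wpDl//.
    by rewrite mulr_ge0 ?sumr_ge0// ?divr_ge0// ltW.
  rewrite mulr_suml !big_nat; apply: ler_sum => k /andP[Nk _].
  by rewrite normrM ler_wpM2l// ltW// eN.
rewrite mulrA (le_trans (ler_wpM2r _ (wD n)))//.
  by rewrite ?divr_ge0// ltW.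
by rewrite mulrC divfK// gt_eqF.
Unshelve. all: by end_near. Qed.

(** Convergence of the normalized weights to [rho] does not imply the absolute
    bound, because the weights need not be of constant sign; the bound is what
    lets a small [e k - l] be neglected. *)
Lemma weighted_mean_cvg {K : numFieldType} {s w e : nat -> K} {C rho l : K} :
  (fun n => (s n)^-1) @ \oo --> (0 : K^o) ->
  (forall n, \sum_(0 <= k < n) `|w k| <= C * `|s n|) ->
  (fun n => (s n)^-1 * \sum_(0 <= k < n) w k) @ \oo --> (rho : K^o) ->
  e @ \oo --> (l : K^o) ->
  (fun n => (s n)^-1 * \sum_(0 <= k < n) w k * e k) @ \oo --> (rho * l : K^o).
Proof.
move=> s0 wC wrho el.
have el0 : (fun k => e k - l) @ \oo --> (0 : K^o) by exact/(@subr_cvg0 _ K^o).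
rewrite -[rho * l]add0r (_ : (fun n => _) = (fun n =>
    (s n)^-1 * (\sum_(0 <= k < n) w k * (e k - l)) +
    (s n)^-1 * (\sum_(0 <= k < n) w k) * l)).
  apply: (@cvgD _ K^o); first exact: weighted_sum_cvg0 s0 wC el0.
  by apply: cvgMr_tmp; exact: wrho.
apply/funext => n; rewrite -mulrA -mulrDr mulr_suml -big_split/=.
by congr (_ * _); apply: eq_bigr => k _; rewrite mulrBr subrK.
Qed.

(** Indices are shifted so that [b] is read from [1] on while [u] is read from
    [0] on. *)
Lemma summation_by_parts {K : comPzRingType} (b u : nat -> K) (n : nat) :
  \sum_(0 <= k < n) b k.+1 * u k.+1 =
  (\sum_(0 <= k < n) b k.+1) * u n -
  \sum_(0 <= k < n) (\sum_(0 <= j < k) b j.+1) * (u k.+1 - u k).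
Proof.
elim: n => [|n IHn]; first by rewrite !big_nil mul0r subr0.
by rewrite !big_nat_recr//= IHn; ring.
Qed.

(** * Real powers of natural numbers *)

Lemma telescope_nat_powR {R : realType} {r : R} (n : nat) : 0 < r ->
  \sum_(0 <= k < n) ((k.+1%:R : R) `^ r - k%:R `^ r) = n%:R `^ r.
Proof.
by move=> r0; rewrite telescope_sumr// powR0 ?gt_eqF// subr0.
Qed.

(** These are the difference quotients at [1] of [x |-> x^r], for the step
    [1 / (n + 1)]. *)
Lemma powR_increment_cvg {R : realType} (r : R) :
  (fun n : nat => n.+1%:R * ((1 + n.+1%:R^-1) `^ r - 1)) @ \oo --> r.
Proof.
have [dr] := is_derive1_powR r (@ltr01 R); rewrite powR1 mulr1 => drE.
have {dr drE} dr :
    (fun h : R => h^-1 * ((h * 1 + 1) `^ r - 1 `^ r)) @ 0^' --> r.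
  move/cvg_ex: dr => [l dr].
  have lr : l = r by rewrite -drE -(cvg_lim (@norm_hausdorff R R^o) dr).
  by rewrite lr in dr; exact: dr.
have h0 : (@harmonic R) @ \oo --> 0^'.
  move=> A /= [e e0 eA].
  have /cvgr0Pnorm_lt/(_ _ e0) he := @cvg_harmonic R.
  suff : \forall n \near \oo, A (harmonic n) by [].
  near=> n; apply: eA => /=; last exact: lt0r_neq0 (harmonic_gt0 n).
  by rewrite sub0r normrN; near: n.
rewrite (_ : (fun n => _) = (fun h : R => h^-1 * ((h * 1 + 1) `^ r - 1 `^ r))
  \o harmonic); first exact: cvg_comp h0 dr.
by apply/funext => n /=; rewrite invrK powR1 mulr1 [_ + 1]addrC.
Unshelve. all: by end_near. Qed.

Lemma powR_gt1 {R : realType} {x r : R} : 1 < x -> 0 < r -> 1 < x `^ r.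
Proof.
move=> x1 r0; have := @gt0_ltr_powR R r r0 1 x; rewrite powR1; apply=> //.
  by rewrite nnegrE ler01.
by rewrite nnegrE ltW// (lt_trans ltr01).
Qed.

Lemma nat_powR_inv_cvg0 {R : realType} {r : R} : 0 < r ->
  (fun n : nat => (n%:R `^ r)^-1 : R) @ \oo --> 0.
Proof.
move=> r0; rewrite -cvg_shiftS/=.
apply/gtr0_cvgV0; first by near=> n; exact: powR_gt0.
apply/cvgryPge => A; near=> n.
apply: (@le_trans _ _ ((`|A| `^ r^-1) `^ r)).
  by rewrite -powRrM mulVf ?gt_eqF// powRr1// ler_norm.
rewrite ge0_ler_powR ?nnegrE ?powR_ge0 ?(ltW r0)//.
rewrite (@le_trans _ _ n%:R) ?ler_nat//.
by near: n; exact: nbhs_infty_ger.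
Unshelve. all: by end_near. Qed.

Lemma nat_powRD {R : realType} {p q : R} (n : nat) : 0 < p -> 0 < q ->
  n%:R `^ (p + q) = n%:R `^ p * n%:R `^ q :> R.
Proof. by move=> p0 q0; rewrite powRD// gt_eqF ?addr_gt0. Qed.

Lemma ler_nat_powR {R : realType} {r : R} {k n : nat} : 0 < r -> (k <= n)%N ->
  k%:R `^ r <= n%:R `^ r :> R.
Proof.
by move=> r0 kn; rewrite ge0_ler_powR ?nnegrE ?ler0n ?ler_nat// ltW.
Qed.

Lemma nat_powR_incr_gt0 {R : realType} {r : R} (k : nat) : 0 < r ->
  0 < k.+1%:R `^ r - k%:R `^ r :> R.
Proof.
move=> r0; rewrite subr_gt0 gt0_ltr_powR ?nnegrE ?ler0n//.
by rewrite ltr_nat.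
Qed.

(** Factoring [(k + 1)^r] out of the increment lets the powers cancel when
    two increments of different exponents are divided, leaving only difference
    quotients. *)
Lemma nat_powR_increment {R : realType} (r : R) (k : nat) :
  k.+2%:R `^ r - k.+1%:R `^ r =
  k.+1%:R `^ r / k.+1%:R * (k.+1%:R * ((1 + k.+1%:R^-1) `^ r - 1)) :> R.
Proof.
have k0 : k.+1%:R != 0 :> R by rewrite pnatr_eq0.
have -> : k.+2%:R = k.+1%:R * (1 + k.+1%:R^-1) :> R.
  by rewrite mulrDr mulr1 divff// -natr1.
rewrite powRM ?addr_ge0 ?invr_ge0 ?ler01//.
by rewrite mulrA divfK// mulrBr mulr1.
Qed.

Lemma nat_powR_increment_ratio_cvg {R : realType} {p q : R} : 0 < p -> 0 < q ->
  (fun k : nat => k%:R `^ p * (k.+1%:R `^ q - k%:R `^ q) /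
     (k.+1%:R `^ (p + q) - k%:R `^ (p + q))) @ \oo --> q / (p + q).
Proof.
move=> p0 q0; have pq0 : 0 < p + q by rewrite addr_gt0.
rewrite -cvg_shiftS/=.
rewrite (_ : (fun n => _) = (fun k : nat =>
    (k.+1%:R * ((1 + k.+1%:R^-1) `^ q - 1)) *
    (k.+1%:R * ((1 + k.+1%:R^-1) `^ (p + q) - 1))^-1 : R)).
  apply: (@cvgM R); first exact: powR_increment_cvg.
  by apply: (@cvgV R); [rewrite gt_eqF|exact: powR_increment_cvg].
apply/funext => k; rewrite !nat_powR_increment nat_powRD//.
have k0 : k.+1%:R != 0 :> R by rewrite pnatr_eq0.
have kp : k.+1%:R `^ p != 0 :> R by rewrite gt_eqF// powR_gt0.
have kq : k.+1%:R `^ q != 0 :> R by rewrite gt_eqF// powR_gt0.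
have x0 : (1 + k.+1%:R^-1) `^ (p + q) - 1 != 0 :> R.
  by rewrite gt_eqF// subr_gt0 powR_gt1// ltrDl invr_gt0.
by field; rewrite nat1r x0 k0 kp kq.
Qed.

Lemma nat_powR_mean_cvg {R : realType} {p q : R} : 0 < p -> 0 < q ->
  (fun n : nat => (n%:R `^ (p + q))^-1 *
     \sum_(0 <= k < n) k%:R `^ p * (k.+1%:R `^ q - k%:R `^ q))
    @ \oo --> q / (p + q).
Proof.
move=> p0 q0; have pq0 : 0 < p + q by rewrite addr_gt0.
pose w k : R := k.+1%:R `^ (p + q) - k%:R `^ (p + q).
pose e k : R := k%:R `^ p * (k.+1%:R `^ q - k%:R `^ q) / w k.
have wn0 k : w k != 0 by rewrite gt_eqF// nat_powR_incr_gt0.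
rewrite (_ : (fun n => _) = (fun n : nat => (n%:R `^ (p + q))^-1 *
    \sum_(0 <= k < n) w k * e k)); last first.
  apply/funext => n; congr (_ * _); apply: eq_bigr => k _.
  by rewrite [RHS]mulrC divfK.
rewrite -[q / _]mul1r.
apply: (@weighted_mean_cvg R _ _ _ 1).
- exact: nat_powR_inv_cvg0.
- move=> n; rewrite mul1r ger0_norm ?powR_ge0// -telescope_nat_powR//.
  by apply: ler_sum => k _; rewrite ger0_norm// ltW// nat_powR_incr_gt0.
- rewrite -cvg_shiftS/= (_ : (fun n => _) = cst 1); first exact: (@cvg_cst R^o).
  by apply/funext => n; rewrite telescope_nat_powR// mulVf// gt_eqF// powR_gt0.
- exact: nat_powR_increment_ratio_cvg.
Qed.

(** * Transfer to the complex numbers *)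

Lemma normc_real {R : realType} (x : R) : `|x%:C| = `|x|%:C.
Proof. by rewrite normc_def/= expr0n/= addr0 sqrtr_sqr. Qed.

(** A positive complex tolerance is a real one, its imaginary part being [0]. *)
Lemma real_complex_cvg {R : realType} {u : nat -> R} {l : R} :
  u @ \oo --> l -> (fun n => (u n)%:C) @ \oo --> (l%:C : R[i]^o).
Proof.
move=> ul; apply/(@cvgrPdist_lt _ R[i]^o) => -[e e'].
rewrite ltcE/= => /andP[/eqP -> e0].
have /cvgrPdist_lt/(_ _ e0) := ul; apply: filterS => n.
by rewrite -rmorphB/= normc_real ltcR.
Qed.

Lemma npow_ge0 {R : realType} (n : nat) (r : R) : 0 <= npow n r.
Proof. by rewrite lecR powR_ge0. Qed.

Lemma npow_norm {R : realType} (n : nat) (r : R) : `|npow n r| = npow n r.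
Proof. by rewrite ger0_norm// npow_ge0. Qed.

Lemma npow_neq0 {R : realType} (n : nat) (r : R) : (0 < n)%N -> npow n r != 0.
Proof.
by move=> n0; rewrite gt_eqF// ltcR powR_gt0// ltr0n.
Qed.

Lemma npow0 {R : realType} {r : R} : 0 < r -> npow 0 r = 0.
Proof. by move=> r0; rewrite /npow powR0 ?gt_eqF. Qed.

Lemma npowD {R : realType} {p q : R} (n : nat) : 0 < p -> 0 < q ->
  npow n (p + q) = npow n p * npow n q.
Proof. by move=> p0 q0; rewrite /npow nat_powRD// rmorphM. Qed.

Lemma npow_inv_cvg0 {R : realType} {r : R} : 0 < r ->
  (fun n : nat => (npow n r)^-1) @ \oo --> (0 : R[i]^o).
Proof.
move=> r0; have := real_complex_cvg (nat_powR_inv_cvg0 r0).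
by under eq_fun do rewrite fmorphV.
Qed.

(** Division by [n^r] is reversible even at [n = 0], where [0^r = 0], for
    sequences that start at [0]; partial sums do. *)
Lemma npow_mulVK {R : realType} {r : R} {x : nat -> R[i]} : 0 < r -> x 0 = 0 ->
  forall n, x n = npow n r * ((npow n r)^-1 * x n).
Proof.
move=> r0 x0 [|n]; first by rewrite x0 !mulr0.
by rewrite mulVKf// npow_neq0.
Qed.

(** Summation by parts replaces the sequence [b_], of which nothing is known
    termwise, by its partial sums, which
    are [b * n^p + o(n^p)]; the new weights are nonnegative reals. *)
Lemma powR_weighted_sum_cvg {R : realType} {p q : R} (hp : 0 < p) (hq : 0 < q)
  {b_ : nat -> R[i]} {b : R[i]} :
  (fun n : nat => (npow n p)^-1 * \sum_(1 <= k < n.+1) b_ k) @ \oo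
    --> (b : R[i]^o) ->
  (fun n : nat => (npow n (p + q))^-1 * \sum_(1 <= k < n.+1) b_ k * npow k q)
    @ \oo --> (b * p%:C / (p + q)%:C : R[i]^o).
Proof.
move=> hb; have pq0 : 0 < p + q by rewrite addr_gt0.
pose beta n := (npow n p)^-1 * \sum_(1 <= k < n.+1) b_ k.
pose w k : R[i] := npow k p * (npow k.+1 q - npow k q).
have wE k : w k = (k%:R `^ p * (k.+1%:R `^ q - k%:R `^ q))%:C.
  by rewrite /w /npow rmorphM rmorphB.
have w_mean : (fun n => (npow n (p + q))^-1 * \sum_(0 <= k < n) w k) @ \oo
    --> ((q / (p + q))%:C : R[i]^o).
  have := real_complex_cvg (nat_powR_mean_cvg hp hq).
  under eq_fun do rewrite rmorphM fmorphV rmorph_sum.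
  by under [in X in _ -> X]eq_fun do under eq_bigr do rewrite wE.
have w_beta : (fun n => (npow n (p + q))^-1 * \sum_(0 <= k < n) w k * beta k)
    @ \oo --> ((q / (p + q))%:C * b : R[i]^o).
  apply: (@weighted_mean_cvg R[i] _ _ _ 1) w_mean hb.
    exact: npow_inv_cvg0.
  (* Bound [k^p] by [n^p]; the increments of [k^q] then telescope. *)
  move=> n; rewrite mul1r npow_norm npowD//.
  have -> : npow n q = \sum_(0 <= k < n) (npow k.+1 q - npow k q) :> R[i].
    by rewrite telescope_sumr// npow0// subr0.
  rewrite mulr_sumr !big_nat; apply: ler_sum => k /= kn.
  rewrite wE normc_real ger0_norm -?wE; last first.
    by rewrite mulr_ge0 ?powR_ge0// ltW// nat_powR_incr_gt0.
  rewrite ler_wpM2r//.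
    by rewrite /npow -rmorphB lecR ltW// nat_powR_incr_gt0.
  by rewrite lecR ler_nat_powR// ltnW.
have -> : b * p%:C / (p + q)%:C = b - (q / (p + q))%:C * b.
  have pqC0 : p%:C + q%:C != 0 by rewrite -rmorphD gt_eqF// ltcR.
  by rewrite rmorphM/= fmorphV/= rmorphD/=; field.
rewrite (_ : (fun n => _) = (fun n => beta n -
    (npow n (p + q))^-1 * \sum_(0 <= k < n) w k * beta k)).
  by apply: (@cvgB _ R[i]^o); [exact: hb|exact: w_beta].
have sumE n : \sum_(0 <= k < n) b_ k.+1 = npow n p * beta n.
  rewrite /beta big_add1/=.
  by rewrite -(npow_mulVK (x := fun n => \sum_(0 <= k < n) b_ k.+1))// big_geq.
apply/funext => -[|n].
  by rewrite /beta !npow0// !invr0 !mul0r subr0.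
rewrite big_add1/= (summation_by_parts b_ (fun k => npow k q)) mulrBr sumE.
congr (_ - _ * _); last by apply: eq_bigr => k _; rewrite sumE /w; ring.
by rewrite npowD//; field; rewrite !npow_neq0.
Qed.

(** * Products of a sequence with box sums *)

(* R[i]^o is R[i] with the topology given by the complex modulus. *)
Theorem proposition3p1 (R : realType) (p q : R) (m : nat)
  (hp : 0 < p) (hq : 0 < q) (hm : (0 < m)%N)
  (b_ : nat -> R[i]) (b : R[i])
  (hb : (fun n : nat => (npow n p)^-1 * \sum_(1 <= k < n.+1) b_ k) @ \oo
          --> (b : R[i]^o))
  (B : R)
  (hB : forall n : nat, (0 < n)%N ->
          (npow n p)^-1 * \sum_(1 <= k < n.+1) `|b_ k| <= B%:C)
  (a_ : m.-tuple nat -> R[i]) (a : R[i])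
  (ha : (fun n : nat => (npow n q)^-1 * box_sum a_ n) @ \oo
          --> (a : R[i]^o)) :
  (fun n : nat => (npow n (p + q))^-1 *
                  \sum_(1 <= k < n.+1) b_ k * box_sum a_ k) @ \oo
    --> (a * b * p%:C / (p + q)%:C : R[i]^o).
Proof.
have pq0 : 0 < p + q by rewrite addr_gt0.
pose w k := b_ k.+1 * npow k.+1 q.
pose alpha k := (npow k.+1 q)^-1 * box_sum a_ k.+1.
have alpha_a : alpha @ \oo --> (a : R[i]^o).
  by move: ha; rewrite -(@cvg_shiftS R[i]^o).
have w_mean : (fun n => (npow n (p + q))^-1 * \sum_(0 <= k < n) w k) @ \oo
    --> (b * p%:C / (p + q)%:C : R[i]^o).
  have := powR_weighted_sum_cvg hp hq hb.
  by under eq_fun do rewrite big_add1/=.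
rewrite (_ : (fun n => _) = (fun n =>
    (npow n (p + q))^-1 * \sum_(0 <= k < n) w k * alpha k)); last first.
  apply/funext => n; rewrite big_add1/=; congr (_ * _); apply: eq_bigr => k _.
  by rewrite /w /alpha -mulrA mulVKf// npow_neq0.
rewrite (_ : a * b * _ / _ = b * p%:C / (p + q)%:C * a); last by ring.
apply: (@weighted_mean_cvg R[i] _ _ _ B%:C) w_mean alpha_a.
  exact: npow_inv_cvg0.
case=> [|n]; first by rewrite big_geq// npow0// normr0 mulr0.
rewrite npow_norm npowD// mulrA; have := hB n.+1 isT.
rewrite big_add1/= ler_pdivrMl; last by rewrite ltcR powR_gt0.
move=> /(ler_wpM2r (npow_ge0 n.+1 q)); rewrite [_ * B%:C]mulrC.
apply: le_trans; rewrite mulr_suml !big_nat; apply: ler_sum => k /= kn.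
by rewrite /w normrM npow_norm ler_wpM2l// lecR ler_nat_powR.
Qed.
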